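(* Let $R$ be a commutative ring with non-zero identity, let $S$ be a multiplicatively closed subset of $R$ such that $J(S^{-1}R)=S^{-1}J(R)$, and let $I$ be a proper ideal of $R$. (1) If $I$ is a weakly $J$-ideal of $R$ such that $I\cap S=\emptyset$, then $S^{-1}I$ is a weakly $J$-ideal of $S^{-1}R$. (2) If $S^{-1}I$ is a weakly $J$-ideal of $S^{-1}R$ and $S\cap Z(R)=S\cap Z_I(R)=S\cap Z_{J(R)}(R)=\emptyset$, then $I$ is a weakly $J$-ideal of $R$.
   Context: $J(A)$ denotes the Jacobson radical of a ring $A$. $Z(R)$ denotes the set of zero divisors of $R$, and for a proper ideal $L$ of $R$, $Z_L(R)=\{r\in R: rs\in L \text{ for some } s\in R\setminus L\}$. $S^{-1}R$ is the localization of $R$ at $S$. A proper ideal $I$ of a ring $A$ is a weakly $J$-ideal if whenever $a,b\in A$ with $0\neq ab\in I$ and $a\notin J(A)$, then $b\in I$. *)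

(* Defs.v *)
From HB Require Import structures.
From mathcomp Require Import all_boot all_algebra.
From mathcomp Require Import generic_quotient ring_quotient.
From mathcomp Require Import ring.
From mathcomp Require Import boolp.

Set Implicit Arguments.
Unset Strict Implicit.
Unset Printing Implicit Defensive.

Import GRing.Theory.
Local Open Scope ring_scope.
Local Open Scope quotient_scope.

(* Everything is stated over commutative rings in which 1 = 0 is allowed,
   because the localization at S is the zero ring when 0 \in S.  Subsets are
   boolean predicates; classically these are all subsets. *)

Section Ideals.
Variable A : comPzRingType.
Implicit Types (I L M : {pred A}) (x r : A).

(* The same formula as [idealr_closed], which requires 1 != 0. *)
Definition is_proper_ideal I : Prop :=
  [/\ 0 \in I, 1 \notin I & forall a, {in I &, forall u v, a * u + v \in I}].

Definition is_maximal_ideal M : Prop :=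
  is_proper_ideal M /\
  forall L, is_proper_ideal L -> {subset M <= L} -> L =i M.

Definition jacobson : {pred A} :=
  [pred x | `[< forall M, is_maximal_ideal M -> x \in M >]].

Definition weakly_J_ideal I : Prop :=
  is_proper_ideal I /\
  forall a b, a * b != 0 -> a * b \in I -> a \notin jacobson -> b \in I.

(* 0 counts as a zero divisor (when 1 != 0). *)
Definition zero_divisors : {pred A} :=
  [pred r | `[< exists2 s, s != 0 & r * s = 0 >]].

Definition zero_divisors_mod L : {pred A} :=
  [pred r | `[< exists2 s, s \notin L & r * s \in L >]].

End Ideals.

Arguments jacobson A : clear implicits.
Arguments zero_divisors A : clear implicits.

Lemma is_proper_idealE (R : comNzRingType) (I : {pred R}) :
  is_proper_ideal I = idealr_closed I.
Proof. by []. Qed.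

Section Localization.
Variables (R : comPzRingType) (S : mulrClosed R).

Definition denom : Type := {s : R | s \in S}.
HB.instance Definition _ := SubChoice.on denom.

Definition mkden (s : R) (sS : s \in S) : denom := exist _ s sS.

Definition preloc : Type := (R * denom)%type.
HB.instance Definition _ := Choice.on preloc.

Definition loc_equiv (x y : preloc) : bool :=
  `[< exists2 u, u \in S & u * (x.1 * val y.2 - y.1 * val x.2) = 0 >].

Lemma loc_equiv_refl : reflexive loc_equiv.
Proof.
by move=> x; apply/asboolP; exists 1; rewrite ?rpred1// subrr mulr0.
Qed.

Lemma loc_equiv_sym : symmetric loc_equiv.
Proof.
by move=> x y; apply/asboolP/asboolP => -[u uS e]; exists u => //;
   rewrite -opprB mulrN e oppr0.
Qed.

Lemma loc_equiv_trans : transitive loc_equiv.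
Proof.
move=> y x z /asboolP[u uS e] /asboolP[v vS f]; apply/asboolP.
exists (u * v * val y.2); first by rewrite !rpredM//; exact: valP.
transitivity (v * val z.2 * (u * (x.1 * val y.2 - y.1 * val x.2))
  + u * val x.2 * (v * (y.1 * val z.2 - z.1 * val y.2))); first by ring.
by rewrite e f !mulr0 addr0.
Qed.

Canonical loc_equivRel :=
  EquivRel loc_equiv loc_equiv_refl loc_equiv_sym loc_equiv_trans.

Definition loc : Type := {eq_quot loc_equiv}.
HB.instance Definition _ := Choice.on loc.
HB.instance Definition _ := EqQuotient.on loc.

Definition locfrac (a : R) (s : denom) : loc := \pi_loc (a, s).

Lemma locfracP (a b : R) (s t : denom) :
  locfrac a s = locfrac b t <->
  exists2 u, u \in S & u * (a * val t - b * val s) = 0.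
Proof.
rewrite /locfrac; split; first by move=> /eqmodP /asboolP.
by move=> h; apply/eqmodP/asboolP.
Qed.

Definition den1 : denom := mkden (rpred1 S).
Definition denM (s t : denom) : denom := mkden (rpredM (valP s) (valP t)).

Definition loc_zero : loc := locfrac 0 den1.
Definition loc_one : loc := locfrac 1 den1.
Definition loc_opp (x : loc) : loc := locfrac (- (repr x).1) (repr x).2.
Definition loc_add (x y : loc) : loc :=
  locfrac ((repr x).1 * val (repr y).2 + (repr y).1 * val (repr x).2)
          (denM (repr x).2 (repr y).2).
Definition loc_mul (x y : loc) : loc :=
  locfrac ((repr x).1 * (repr y).1) (denM (repr x).2 (repr y).2).

Lemma loc_repr x : locfrac (repr x).1 (repr x).2 = x.
Proof. by rewrite /locfrac -surjective_pairing reprK. Qed.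

Variant loc_spec : loc -> Type := LocSpec a s : loc_spec (locfrac a s).

Lemma locP x : loc_spec x.
Proof. by rewrite -(loc_repr x). Qed.

Lemma repr_locfrac a s :
  exists2 u, u \in S &
    u * ((repr (locfrac a s)).1 * val s - a * val (repr (locfrac a s)).2) = 0.
Proof. by apply/locfracP; rewrite loc_repr. Qed.

Lemma loc_oppE a s : loc_opp (locfrac a s) = locfrac (- a) s.
Proof.
have [u uS e] := repr_locfrac a s; apply/locfracP; exists u => //.
by move: e; set p := repr _ => e; rewrite -[RHS]oppr0 -e; ring.
Qed.

Lemma loc_addE a s b t : loc_add (locfrac a s) (locfrac b t) =
  locfrac (a * val t + b * val s) (denM s t).
Proof.
have [u uS] := repr_locfrac a s; have [v vS] := repr_locfrac b t.
move=> f e; rewrite /loc_add; move: e f.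
set p := repr _ => e; set q := repr _ => f.
apply/locfracP; exists (u * v); first by rewrite rpredM.
transitivity (v * val q.2 * val t * (u * (p.1 * val s - a * val p.2))
  + u * val p.2 * val s * (v * (q.1 * val t - b * val q.2))).
  by rewrite /=; ring.
by rewrite e f !mulr0 addr0.
Qed.

Lemma loc_mulE a s b t : loc_mul (locfrac a s) (locfrac b t) =
  locfrac (a * b) (denM s t).
Proof.
have [u uS] := repr_locfrac a s; have [v vS] := repr_locfrac b t.
move=> f e; rewrite /loc_mul; move: e f.
set p := repr _ => e; set q := repr _ => f.
apply/locfracP; exists (u * v); first by rewrite rpredM.
transitivity (v * q.1 * val t * (u * (p.1 * val s - a * val p.2))
  + u * val p.2 * a * (v * (q.1 * val t - b * val q.2))).
  by rewrite /=; ring.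
by rewrite e f !mulr0 addr0.
Qed.

Lemma locfrac_eq a s b t : a * val t = b * val s -> locfrac a s = locfrac b t.
Proof.
by move=> e; apply/locfracP; exists 1; rewrite ?rpred1// e subrr mulr0.
Qed.

Lemma loc_addA : associative loc_add.
Proof.
move=> x y z; case: (locP x) (locP y) (locP z) => a s [b t] [c r].
by rewrite !loc_addE; apply: locfrac_eq => /=; ring.
Qed.

Lemma loc_addC : commutative loc_add.
Proof.
move=> x y; case: (locP x) (locP y) => a s [b t].
by rewrite !loc_addE; apply: locfrac_eq => /=; ring.
Qed.

Lemma loc_add0 : left_id loc_zero loc_add.
Proof.
move=> x; case: (locP x) => a s.
by rewrite !loc_addE; apply: locfrac_eq => /=; ring.
Qed.

Lemma loc_addN : left_inverse loc_zero loc_opp loc_add.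
Proof.
move=> x; case: (locP x) => a s.
by rewrite loc_oppE !loc_addE; apply: locfrac_eq => /=; ring.
Qed.

Lemma loc_mulA : associative loc_mul.
Proof.
move=> x y z; case: (locP x) (locP y) (locP z) => a s [b t] [c r].
by rewrite !loc_mulE; apply: locfrac_eq => /=; ring.
Qed.

Lemma loc_mulC : commutative loc_mul.
Proof.
move=> x y; case: (locP x) (locP y) => a s [b t].
by rewrite !loc_mulE; apply: locfrac_eq => /=; ring.
Qed.

Lemma loc_mul1 : left_id loc_one loc_mul.
Proof.
move=> x; case: (locP x) => a s.
by rewrite !loc_mulE; apply: locfrac_eq => /=; ring.
Qed.

Lemma loc_mulDl : left_distributive loc_mul loc_add.
Proof.
move=> x y z; case: (locP x) (locP y) (locP z) => a s [b t] [c r].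
by rewrite !(loc_addE, loc_mulE); apply: locfrac_eq => /=; ring.
Qed.

HB.instance Definition _ := GRing.isZmodule.Build loc
  loc_addA loc_addC loc_add0 loc_addN.
HB.instance Definition _ := GRing.Zmodule_isComPzRing.Build loc
  loc_mulA loc_mulC loc_mul1 loc_mulDl.

Lemma locfracD a s b t : locfrac a s + locfrac b t =
  locfrac (a * val t + b * val s) (denM s t).
Proof. exact: loc_addE. Qed.

Lemma locfracM a s b t :
  locfrac a s * locfrac b t = locfrac (a * b) (denM s t).
Proof. exact: loc_mulE. Qed.

Definition loc_ideal (I : {pred R}) : {pred loc} :=
  [pred x | `[< exists2 a, a \in I & exists s, x = locfrac a s >]].

End Localization.

Arguments loc_ideal {R} S I.

(* Main.v *)
(** A fraction a/s lies in S^-1 L exactly when u a lies in L for some u in S.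
    Products of fractions are thus controlled by products in R up to a factor
    u in S: in (1) this factor is absorbed into b, which does not affect
    whether b/t lies in S^-1 I; in (2) it is cancelled modulo 0, I and J(R)
    by the three disjointness hypotheses. *)
Require Import Defs.
From mathcomp Require Import all_boot all_algebra.
From mathcomp Require Import ring boolp.

Local Open Scope ring_scope.

Import GRing.Theory.

Lemma proper_ideal_mull (A : comPzRingType) (I : {pred A}) (r a : A) :
  is_proper_ideal I -> a \in I -> r * a \in I.
Proof. by case=> I0 _ Ilin aI; rewrite -[r * a]addr0; apply: Ilin. Qed.

Lemma jacobson_mull (A : comPzRingType) (r a : A) :
  a \in jacobson A -> r * a \in jacobson A.
Proof.
move=> /asboolP aJ; apply/asboolP => M maxM.
by apply: proper_ideal_mull (aJ M maxM); case: maxM.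
Qed.

Section LocalizationMembership.
Variables (R : comPzRingType) (S : mulrClosed R).
Implicit Types (I : {pred R}) (a : R) (s : denom S).

Lemma locfrac_eq0P a s :
  locfrac a s = 0 <-> exists2 u, u \in S & u * a = 0.
Proof.
rewrite (_ : 0 = locfrac 0 (den1 S)) // locfracP /= mulr1 mul0r subr0.
by [].
Qed.

(** If [a/s = c/t] with [c] in [I], some [u] in [S] gives [(u t) a = (u s) c], which lies in [I];
    conversely [a/s = (u a)/(u s)]. Assuming only absorption lets this serve both [I] and
    [jacobson R]. *)
Lemma loc_idealP I a s : (forall r x, x \in I -> r * x \in I) ->
  locfrac a s \in loc_ideal S I <-> exists2 u, u \in S & u * a \in I.
Proof.
move=> Imul; split=> [/asboolP[c cI [t /locfracP[u uS e]]]|[u uS uaI]].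
  exists (u * val t); first by rewrite rpredM //; exact: valP.
  have -> : u * val t * a = u * val s * c.
    by apply/eqP; rewrite -subr_eq0; apply/eqP; rewrite -e; ring.
  exact: Imul.
apply/asboolP; exists (u * a) => //; exists (denM (mkden uS) s).
by apply: locfrac_eq => /=; ring.
Qed.

Arguments loc_idealP {I a s}.

Lemma loc_ideal_proper I : is_proper_ideal I -> [predI I & S] =i pred0 ->
  is_proper_ideal (loc_ideal S I).
Proof.
move=> Iid IS0; have Imul r x := proper_ideal_mull _ I r x Iid.
case: (Iid) => I0 _ Ilin; split.
- by apply/asboolP; exists 0 => //; exists (den1 S).
(* The unit is the fraction [1/1], so its membership puts [u] itself in both [I] and [S]. *)
- apply/negP => /(loc_idealP Imul)[u uS]; rewrite mulr1 => uI.
  by have := IS0 u; rewrite !inE uI uS.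
move=> x y z; case: (locP x) (locP y) (locP z) => a s [b t] [c r].
move=> /(loc_idealP Imul)[u uS ubI] /(loc_idealP Imul)[v vS vcI].
rewrite locfracM locfracD; apply/(loc_idealP Imul).
exists (u * v); first exact: rpredM.
have -> : u * v * (a * b * val r + c * val (denM s t)) =
    (v * a * val r) * (u * b) + u * val s * val t * (v * c) by rewrite /=; ring.
by apply: Ilin => //; apply: Imul.
Qed.

End LocalizationMembership.

Arguments locfrac_eq0P {R S a s}.
Arguments loc_idealP {R S I a s}.

(** Otherwise [a] would witness that [u] is a zero divisor modulo [L]. *)
Lemma zero_divisors_mod_cancel (A : comPzRingType) (S L : {pred A}) (u a : A) :
  [predI S & zero_divisors_mod L] =i pred0 ->
  u \in S -> u * a \in L -> a \in L.
Proof.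
move=> SL uS uaL; apply: contraT => aL.
have := SL u; rewrite !inE uS /= => /negbT /asboolP[].
by exists a.
Qed.

Theorem proposition6 (R : comNzRingType) (S : mulrClosed R)
    (hJ : jacobson (loc S) =i loc_ideal S (jacobson R))
    (I : {pred R}) (hI : is_proper_ideal I) :
  (weakly_J_ideal I -> [predI I & S] =i pred0 ->
     weakly_J_ideal (loc_ideal S I))
  /\
  (weakly_J_ideal (loc_ideal S I) ->
     [predI S & zero_divisors R] =i pred0 ->
     [predI S & zero_divisors_mod I] =i pred0 ->
     [predI S & zero_divisors_mod (jacobson R)] =i pred0 ->
     weakly_J_ideal I).
Proof.
have Imul r x := proper_ideal_mull _ I r x hI.
have Jmul r x := jacobson_mull R r x.
split=> [[_ wJ] IS0|[_ wJ] SZ SI SJ]; split=> //.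
- exact: loc_ideal_proper.
- move=> x y; case: (locP x) (locP y) => a s [b t].
  rewrite locfracM => ab0 /(loc_idealP Imul)[u uS uabI] aJ.
  (* Regroup [u (a b)] as [a (u b)] and apply the hypothesis to [a] and [u b]. *)
  apply/(loc_idealP Imul); exists u => //.
  apply: (wJ a); rewrite 1?mulrCA //.
    apply: contraNneq ab0 => uab0.
    by apply/eqP/locfrac_eq0P; exists u.
  apply: contra aJ => aJ; rewrite hJ; apply/(loc_idealP Jmul).
  by exists 1; rewrite ?rpred1 ?mul1r.
move=> a b ab0 abI aJ.
(* Pass to [a/1] and [b/1]; the resulting [u] with [u b] in [I] cancels modulo [I]. *)
suff /(loc_idealP Imul)[u uS ubI] :
    locfrac b (den1 S) \in loc_ideal S I by exact: zero_divisors_mod_cancel SI uS ubI.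
apply: (wJ (locfrac a (den1 S))); rewrite ?locfracM.
(* If [(a b)/1] vanished, some [u] in [S] would kill the nonzero [a b]. *)
- apply/eqP => /locfrac_eq0P[u uS uab0].
  have := SZ u; rewrite !inE uS /= => /negbT /asboolP[].
  by exists (a * b).
- by apply/(loc_idealP Imul); exists 1; rewrite ?rpred1 ?mul1r.
apply: contra aJ; rewrite hJ => /(loc_idealP Jmul)[u uS uaJ].
exact: zero_divisors_mod_cancel SJ uS uaJ.
Qed.
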